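(* Let $g$ be the genus (a positive integer) and let $\mathcal{H}_{\mathcal{C}}\subset(\mathbb{C}^* )^{2^g}\times\mathbb{W}\mathbb{P}^{3g-1}$ be the Hirota variety associated to an irreducible rational nodal curve of genus $g$, with main component $\mathcal{H}_{\mathcal{C}}^M$, as defined in the context. If $g\le 9$, then the subvariety $\mathcal{H}_{\mathcal{C}}^{M}$ is an irreducible component of $\mathcal{H}_{\mathcal{C}}$.
   Context: Let $\mathcal{C}=\{0,1\}^g\subset\mathbb{Z}^g$. The space $(\mathbb{C}^* )^{2^g}\times \mathbb{W}\mathbb{P}^{3g-1}$ has coordinates $\mathbf{a}=(a_{\mathbf{c}})_{\mathbf{c}\in\mathcal{C}}$ on the torus and $\mathbf{u}=(u_1,\dots,u_g)$, $\mathbf{v}=(v_1,\dots,v_g)$, $\mathbf{w}=(w_1,\dots,w_g)$ on the weighted projective space, with $\deg u_i=1$, $\deg v_i=2$, $\deg w_i=3$. Hirota variety. For an irreducible rational nodal curve of genus $g$ the degenerate theta function is $\theta_{\mathcal{C}}(\mathbf{z})=\sum_{\mathbf{c}\in\mathcal{C}} a_{\mathbf{c}}\exp[\mathbf{c}^T\mathbf{z}]$. The Hirota variety $\mathcal{H}_{\mathcal{C}}$ parameterizes the points $(\mathbf{a},(\mathbf{u},\mathbf{v},\mathbf{w}))$ such that $\tau(x,y,t)=\theta_{\mathcal{C}}(\mathbf{u}x+\mathbf{v}y+\mathbf{w}t)$ satisfies Hirota's bilinear equation $\tau\tau_{xxxx}-4\tau_{xxx}\tau_x+3\tau_{xx}^2+4\tau_x\tau_t-4\tau\tau_{xt}+3\tau\tau_{yy}-3\tau_y^2=0$.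 Explicitly, it is cut out by the following polynomials. Let $P(x,y,t)=x^4+3y^2-4xt$, and for distinct $\mathbf{c},\mathbf{c}'\in\mathcal{C}$ let $P_{\mathbf{c}\mathbf{c}'}=P((\mathbf{c}-\mathbf{c}')\cdot\mathbf{u},(\mathbf{c}-\mathbf{c}')\cdot\mathbf{v},(\mathbf{c}-\mathbf{c}')\cdot\mathbf{w})$. Let $\mathcal{C}^{[2]}$ be the set of all sums of two distinct points of $\mathcal{C}$. Each $\mathbf{d}\in\mathcal{C}^{[2]}$ gives one polynomial: $P_{\mathbf{c}\mathbf{c}'}$ if there is exactly one unordered pair $\{\mathbf{c},\mathbf{c}'\}$ of distinct points with $\mathbf{c}+\mathbf{c}'=\mathbf{d}$, and otherwise $\sum P_{\mathbf{c}\mathbf{c}'}\,a_{\mathbf{c}}a_{\mathbf{c}'}$, summed over all unordered pairs $\{\mathbf{c},\mathbf{c}'\}$ of distinct points of $\mathcal{C}$ with $\mathbf{c}+\mathbf{c}'=\mathbf{d}$. Main component. On $\mathbb{C}^{3g}$ with coordinates $(\lambda_1,\dots,\lambda_g,\kappa_1,\dots,\kappa_{2g})$, let $\phi:\mathbb{C}^{3g}\dashrightarrow(\mathbb{C}^* )^{2^g}\times \mathbb{W}\mathbb{P}^{3g-1}$ be the rational map sending a point to $(\mathbf{a},(\mathbf{u},\mathbf{v},\mathbf{w}))$ where, for $i=1,\dots,g$, $$u_i=\kappa_{2i-1}-\kappa_{2i},\quad v_i=\kappa_{2i-1}^2-\kappa_{2i}^2,\quad w_i=\kappa_{2i-1}^3-\kappa_{2i}^3,$$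 and, for $\mathbf{c}=(c_1,\dots,c_g)\in\mathcal{C}$, $$a_{\mathbf{c}}=\prod_{i,j\in I,\ i<j}(\kappa_i-\kappa_j)\prod_{i:\,c_i=1}\lambda_i,\qquad I=\{2i: c_i=0\}\cup\{2i-1: c_i=1\}.$$ The main component $\mathcal{H}_{\mathcal{C}}^M$ is the Zariski closure of the image of $\phi$; it is contained in $\mathcal{H}_{\mathcal{C}}$.
   Formalization: The case g = 1 is excluded, as the claim fails there: the product of differences is empty, so a_0 = 1 on the image of φ and the main component has dimension 2, while the Hirota variety is irreducible of dimension 3. *)

(* Defs.v *)
From HB Require Import structures.
From mathcomp Require Import all_boot all_order all_algebra.
From mathcomp Require Import boolp classical_sets reals.
From mathcomp Require Import complex mpoly.

Set Implicit Arguments.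
Unset Strict Implicit.
Unset Printing Implicit Defensive.

Import GRing.Theory.

Local Open Scope ring_scope.
Local Open Scope quotient_scope.
Local Open Scope classical_set_scope.

Definition cube (g : nat) := {ffun 'I_g -> bool}.

Definition cube_vec (g : nat) (c : cube g) : 'rV[int]_g :=
  \row_i (c i : nat)%:Z.

Section AmbientSpace.
Variables (R : realType) (g : nat).

Definition torus := {a : {ffun cube g -> R[i]} | [forall c, a c != 0]}.

(* Rows 0, 1, 2 of a 3 x g matrix are u, v, w, of degrees 1, 2, 3. *)
Definition wscale (t : R[i]) (x : 'M[R[i]]_(3, g)) : 'M[R[i]]_(3, g) :=
  \matrix_(e, i) (t ^+ e.+1 * x e i).

Definition punctured := {x : 'M[R[i]]_(3, g) | x != 0}.

Definition wproj_rel (x y : punctured) : bool :=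
  `[< exists2 t : R[i], t != 0 & val y = wscale t (val x) >].

Lemma wproj_equiv : equiv_class_of wproj_rel.
Proof.
have sc s t x : wscale s (wscale t x) = wscale (s * t) x.
  by apply/matrixP=> e i; rewrite !mxE mulrA exprMn.
have sc1 x : wscale 1 x = x.
  by apply/matrixP=> e i; rewrite !mxE expr1n mul1r.
have half x y : wproj_rel x y -> wproj_rel y x.
  move=> /asboolP[t t0 exy]; apply/asboolP; exists t^-1; rewrite ?invr_eq0 //.
  by rewrite exy sc mulVf // sc1.
split=> [x | x y | y x z].
- by apply/asboolP; exists 1; rewrite ?oner_eq0 ?sc1.
- by apply/idP/idP; apply: half.
- move=> /asboolP[s s0 exy] /asboolP[t t0 eyz]; apply/asboolP.
  by exists (t * s); rewrite ?mulf_neq0 // eyz exy sc.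
Qed.

Canonical wproj_equiv_rel := EquivRelPack wproj_equiv.

Definition wproj := {eq_quot wproj_rel}.

Definition ambient := (torus * wproj)%type.

(* inl c names a_c; inr (0, i), inr (1, i), inr (2, i) name u_i, v_i, w_i. *)
Definition hcoord := (cube g + 'I_3 * 'I_g)%type.

Definition coord_deg (k : hcoord) : nat :=
  match k with inl _ => 0 | inr (e, _) => e.+1 end.

Definition cpoly := {mpoly R[i][#|{: hcoord}|]}.

Definition cvar (k : hcoord) : cpoly := 'X_(enum_rank k).

Definition coord_val (a : {ffun cube g -> R[i]}) (x : 'M[R[i]]_(3, g))
    (k : 'I_#|{: hcoord}|) : R[i] :=
  match enum_val k with inl c => a c | inr (e, i) => x e i end.

Definition whomog (f : cpoly) : Prop :=
  exists d : nat, forall m, m \in msupp f ->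
    (\sum_(k : hcoord) coord_deg k * m (enum_rank k))%N = d.

(* For weighted homogeneous f this does not depend on the representative x. *)
Definition vanishes_at (f : cpoly) (p : ambient) : Prop :=
  forall x : punctured, \pi_wproj x = p.2 ->
    f.@[coord_val (val p.1) (val x)] = 0.

Definition zeros (S : set cpoly) : set ambient :=
  [set p | forall f, S f -> vanishes_at f p].

(* Laurent polynomials in the a_c would give the same closed sets, since
   monomials in the a_c are invertible on the torus. *)
Definition zariski_closed (Z : set ambient) : Prop :=
  exists2 S : set cpoly, S `<=` whomog & Z = zeros S.

Definition zariski_closure (A : set ambient) : set ambient :=
  \bigcap_(Z in [set Z | zariski_closed Z /\ A `<=` Z]) Z.

Definition irreducible_set (Z : set ambient) : Prop :=
  Z !=set0 /\
  forall A B, zariski_closed A -> zariski_closed B ->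
    Z `<=` A `|` B -> Z `<=` A \/ Z `<=` B.

(* Y ranges over all irreducible subsets of H, closed or not; this is the same,
   since the closure of an irreducible set is irreducible. *)
Definition irreducible_component (Z H : set ambient) : Prop :=
  [/\ irreducible_set Z, Z `<=` H &
      forall Y, irreducible_set Y -> Y `<=` H -> Z `<=` Y -> Y = Z].

End AmbientSpace.

Section Hirota.
Variables (R : realType) (g : nat).

Definition hirota_quartic (A : comNzRingType) (x y t : A) : A :=
  x ^+ 4 + 3 * y ^+ 2 - 4 * x * t.

(* P_{cc'}; it is symmetric in c and c' because the quartic is even. *)
Definition hirota_P (c c' : cube g) : cpoly R g :=
  let dot (e : 'I_3) :=
    \sum_i ((cube_vec c - cube_vec c') 0 i)%:~R * cvar R (inr (e, i)) in
  hirota_quartic (dot 0) (dot 1) (dot 2).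

Definition distinct_sum : set 'rV[int]_g :=
  [set d | exists c c' : cube g, c != c' /\ d = cube_vec c + cube_vec c'].

(* An unordered pair of distinct vertices is represented by the ordered pair
   which is increasing for the enumeration of the vertices. *)
Definition pairs_of_sum (d : 'rV[int]_g) : {set cube g * cube g} :=
  [set q | (enum_rank q.1 < enum_rank q.2)%N &
           cube_vec q.1 + cube_vec q.2 == d].

Definition hirota_poly (d : 'rV[int]_g) : cpoly R g :=
  if #|pairs_of_sum d| == 1%N
  then \sum_(q in pairs_of_sum d) hirota_P q.1 q.2
  else \sum_(q in pairs_of_sum d)
         hirota_P q.1 q.2 * cvar R (inl q.1) * cvar R (inl q.2).

Definition hirota_variety : set (ambient R g) :=
  zeros [set hirota_poly d | d in distinct_sum].

Lemma kappa_index_subproof (i : 'I_g) (b : bool) : (2 * i + ~~ b < 2 * g)%N.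
Proof.
apply: (@leq_trans (2 * i.+1)); last by rewrite leq_mul2l ltn_ord.
by rewrite mulnS addnC ltn_add2r; case: b.
Qed.

(* With the 1-based numbering kappa_1, ..., kappa_2g, this is 2i-1 for b = true
   and 2i for b = false; ordinals are 0-based. *)
Definition kappa_index (i : 'I_g) (b : bool) : 'I_(2 * g) :=
  Ordinal (kappa_index_subproof i b).

Definition index_set (c : cube g) : {set 'I_(2 * g)} :=
  [set kappa_index i (c i) | i : 'I_g].

Definition phi_a (lambda : 'I_g -> R[i]) (kappa : 'I_(2 * g) -> R[i])
    (c : cube g) : R[i] :=
  (\prod_(k in index_set c) \prod_(l in index_set c | (k < l)%N)
      (kappa k - kappa l)) *
  \prod_(i | c i) lambda i.

Definition phi_uvw (kappa : 'I_(2 * g) -> R[i]) : 'M[R[i]]_(3, g) :=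
  \matrix_(e, i) (kappa (kappa_index i true) ^+ e.+1
                  - kappa (kappa_index i false) ^+ e.+1).

(* The graph of the rational map phi.  There is a p with phi_graph lambda kappa p
   exactly when the formulas define a point of the ambient space, that is when
   all phi_a are nonzero and phi_uvw is nonzero. *)
Definition phi_graph (lambda : 'I_g -> R[i]) (kappa : 'I_(2 * g) -> R[i])
    (p : ambient R g) : Prop :=
  (forall c, val p.1 c = phi_a lambda kappa c) /\
  exists2 x : punctured R g, val x = phi_uvw kappa & p.2 = \pi_(wproj R g) x.

(* For g = 1 the product of differences is empty, so a_0 = 1 on the image of
   phi: this closure then has dimension 2, while hirota_variety is irreducible
   of dimension 3.  For g >= 2, scaling kappa scales all the a_c by t^(g(g-1)/2),
   and the closure has dimension 3g. *)
Definition main_component : set (ambient R g) :=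
  zariski_closure [set p | exists lambda kappa, phi_graph lambda kappa p].

End Hirota.

Arguments hirota_variety R g : clear implicits.
Arguments main_component R g : clear implicits.

(* Main.v *)
Require Import Defs.
From mathcomp Require Import all_boot all_order all_algebra.
From mathcomp Require Import boolp classical_sets reals complex mpoly.
From mathcomp Require Import ring.

(* That the image of phi lies in the Hirota variety amounts, for each d, to an
   identity between the 2g numbers kappa: the sum over all orientations of n
   pairs (x_i, y_i) of P times the product of the Vandermonde determinants of
   the x's and of the y's is zero. It follows by induction on n: as a polynomial
   in x_1 the sum has degree at most n + 1, and it vanishes when x_1 equals one
   of the 2n - 1 other numbers, since the sum then reduces to one with n - 1
   pairs.

   Conversely, consider a point of the Hirota variety with all u_i nonzero and
   with kappas that are distinct for distinct i. The edges of the cube give w in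
   terms of u and v, hence kappa, and the squares of the cube give
   a_{c+e_i+e_j} a_c / (a_{c+e_i} a_{c+e_j}). So a is the value of phi up to
   lambda and a common factor, and for g >= 2 rescaling kappa produces that
   factor without moving the point of the weighted projective space. Hence the
   Hirota variety agrees with the image of phi on a nonempty open set, and the
   image is irreducible because it is parametrized. *)

Set Implicit Arguments.
Unset Strict Implicit.
Unset Printing Implicit Defensive.

Import Order.TTheory GRing.Theory Num.Theory.

Local Open Scope ring_scope.

(** * The Hirota identity for pairs of numbers *)

Section Orientations.
Variable F : idomainType.
Implicit Types (p q : F * F) (s t : seq (F * F)) (f h : seq (F * F) -> F).

Definition flip p : F * F := (p.2, p.1).

Fixpoint orient_sum f s : F :=
  if s is p :: s' then orient_sum (f \o cons p) s' +
                       orient_sum (f \o cons (flip p)) s'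
  else f [::].

Lemma eq_orient_sum f h s :
  (forall t, size t = size s -> f t = h t) -> orient_sum f s = orient_sum h s.
Proof.
elim: s f h => [|p s IHs] f h eqfh /=; first exact: eqfh.
by congr (_ + _); apply: IHs => t tn; rewrite /= eqfh //= tn.
Qed.

Lemma orient_sumZ c f s :
  orient_sum (fun t => c * f t) s = c * orient_sum f s.
Proof.
elim: s f => //= p s IHs f.
by rewrite mulrDr -!IHs.
Qed.

Lemma orient_sum0 s : orient_sum (fun=> 0) s = 0.
Proof. by elim: s => //= p s IHs; rewrite IHs addr0. Qed.

(** Factors symmetric under [flip] have the same product on all orientations of [s]. *)
Lemma orient_sum_prodl (k : F * F -> F) f s : (forall p, k (flip p) = k p) ->
  orient_sum (fun t => (\prod_(p <- t) k p) * f t) s =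
  (\prod_(p <- s) k p) * orient_sum f s.
Proof.
move=> kE; elim: s f => [|p s IHs] f /=; first by rewrite !big_nil.
have step r : k r = k p ->
    orient_sum ((fun t => (\prod_(p <- t) k p) * f t) \o cons r) s =
    (\prod_(p <- s) k p) * (k p * orient_sum (f \o cons r) s).
  move=> kr; rewrite -orient_sumZ -IHs.
  by apply: eq_orient_sum => t _; rewrite /= big_cons kr; ring.
by rewrite !step // big_cons; ring.
Qed.

(** * Reordering and flipping pairs *)

Definition exchange_invariant f :=
  forall l p q t, f (l ++ p :: q :: t) = f (l ++ q :: p :: t).

Lemma exchange_invariant_cons f p :
  exchange_invariant f -> exchange_invariant (f \o cons p).
Proof. by move=> fx l; apply: (fx (p :: l)). Qed.

(** Relates lists that differ by reordering and flipping pairs. The equality of sizes keeps track of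
    the number of pairs for the later induction. *)
Definition orient_equiv s t :=
  size s = size t /\
  forall f, exchange_invariant f -> orient_sum f s = orient_sum f t.

Lemma orient_equiv_trans s t r :
  orient_equiv s t -> orient_equiv t r -> orient_equiv s r.
Proof.
by move=> [n1 E1] [n2 E2]; split=> [|f fx]; rewrite ?n1 // E1 // E2.
Qed.

Lemma orient_equiv_cons p s t :
  orient_equiv s t -> orient_equiv (p :: s) (p :: t).
Proof.
move=> [st E]; split=> [|f fx] /=; first by rewrite st.
by rewrite !E //; apply: exchange_invariant_cons.
Qed.

Lemma orient_equiv_flip x y s : orient_equiv ((x, y) :: s) ((y, x) :: s).
Proof. by split=> //= f _; rewrite addrC. Qed.

Lemma orient_equiv_swap p q s : orient_equiv (p :: q :: s) (q :: p :: s).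
Proof.
split=> //= f fx.
have E r r' : orient_sum ((f \o cons r) \o cons r') s =
              orient_sum ((f \o cons r') \o cons r) s.
  by apply: eq_orient_sum => t _; apply: (fx [::]).
by rewrite addrACA; congr (_ + _ + (_ + _)); rewrite E.
Qed.

Definition endpoints s := flatten [seq [:: p.1; p.2] | p <- s].

Lemma size_endpoints s : size (endpoints s) = (2 * size s)%N.
Proof. by elim: s => //= p s ->; rewrite mulnS. Qed.

Lemma mem_endpointsP z s : z \in endpoints s ->
  exists w t, orient_equiv s ((z, w) :: t).
Proof.
elim: s => //= -[x y] s IHs; rewrite !inE => /or3P[/eqP->|/eqP->|/IHs[w [t st]]].
- by exists y, s; split.
- by exists x, s; apply: orient_equiv_flip.
- exists w, ((x, y) :: t); apply: orient_equiv_trans (orient_equiv_swap _ _ _).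
  exact: orient_equiv_cons.
Qed.

(** Two equal numbers lie either in one pair or in two different pairs; flips and exchanges bring
    these pairs to the front, with the common value first. *)
Lemma not_uniq_endpointsP s : ~~ uniq (endpoints s) ->
  (exists z t, orient_equiv s ((z, z) :: t)) \/
  (exists z x y t, orient_equiv s ((z, x) :: (z, y) :: t)).
Proof.
elim: s => //= -[x y] s IHs; rewrite inE negb_and negb_or !negb_and !negbK /=.
have two z w : z \in endpoints s -> exists z' x' y' t,
    orient_equiv ((z, w) :: s) ((z', x') :: (z', y') :: t).
  move=> /mem_endpointsP[w' [t st]]; exists z, w, w', t.
  exact: orient_equiv_cons.
case/or3P=> [/orP[/eqP->|/two xs]|/two ys|/IHs].
- by left; exists y, s; split.
- by right; apply: xs.
- right; have [z [x' [y' [t st]]]] := ys x; exists z, x', y', t.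
  exact: orient_equiv_trans (orient_equiv_flip _ _ _) st.
- case=> [[z [t st]]|[z [x' [y' [t st]]]]]; [left|right].
    exists z, ((x, y) :: t); apply: orient_equiv_trans (orient_equiv_swap _ _ _).
    exact: orient_equiv_cons.
  exists z, x', y', ((x, y) :: t).
  apply: orient_equiv_trans (orient_equiv_cons _ st) _.
  apply: orient_equiv_trans (orient_equiv_swap _ _ _) _.
  apply: orient_equiv_cons; exact: orient_equiv_swap.
Qed.

(** * Functions given by polynomials of bounded degree *)

Definition bounded_poly (n : nat) (k : F -> F) :=
  exists2 P : {poly F}, (size P <= n)%N & forall x, P.[x] = k x.

Lemma bounded_polyD n k1 k2 : bounded_poly n k1 -> bounded_poly n k2 ->
  bounded_poly n (fun x => k1 x + k2 x).
Proof.
move=> [P1 n1 E1] [P2 n2 E2]; exists (P1 + P2) => [|x]; last first.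
  by rewrite hornerD E1 E2.
by rewrite (leq_trans (size_polyD _ _)) // geq_max n1.
Qed.

Lemma bounded_polyM m n k1 k2 : bounded_poly m.+1 k1 -> bounded_poly n.+1 k2 ->
  bounded_poly (m + n).+1 (fun x => k1 x * k2 x).
Proof.
move=> [P1 n1 E1] [P2 n2 E2]; exists (P1 * P2) => [|x]; last first.
  by rewrite hornerM E1 E2.
rewrite (leq_trans (size_polyMleq _ _)) // -subn1 leq_subLR.
by rewrite (leq_trans (leq_add n1 n2)) // addSn addnS add1n.
Qed.

Lemma bounded_poly_prod (T : Type) (r : seq T) (k : T -> F -> F) :
  (forall i, bounded_poly 2 (k i)) ->
  bounded_poly (size r).+1 (fun x => \prod_(i <- r) k i x).
Proof.
move=> kP; elim: r => [|i r IHr].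
  by exists 1 => [|x]; rewrite ?size_poly1 // hornerE big_nil.
have [P nP E] := bounded_polyM (kP i) IHr.
by exists P => // x; rewrite E big_cons.
Qed.

Lemma bounded_poly_affine (a b c : F) : bounded_poly 2 (fun x => (a * x + b) * c).
Proof.
exists ((a%:P * 'X + b%:P) * c%:P) => [|x]; last by rewrite !hornerE.
rewrite (leq_trans (size_polyMleq _ _)) //.
rewrite (leq_trans (_ : _ <= (2 + 1).-1)%N) // -!subn1 leq_sub2r //.
apply: leq_add; last by rewrite size_polyC; case: eqP.
by rewrite size_MXaddC; case: ifP => // _; rewrite ltnS size_polyC; case: eqP.
Qed.

Lemma bounded_poly_orient_sum n (f : F -> seq (F * F) -> F) s :
  (forall t, size t = size s -> bounded_poly n (f ^~ t)) ->
  bounded_poly n (fun x => orient_sum (f x) s).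
Proof.
elim: s f => [|p s IHs] f fP /=; first exact: fP.
by apply: bounded_polyD; apply: (IHs (fun x => f x \o cons _)) => t tn;
  apply: fP; rewrite /= tn.
Qed.

Lemma bounded_poly_eq0 n k (rs : seq F) : bounded_poly n k -> uniq rs ->
  (n <= size rs)%N -> (forall x, x \in rs -> k x = 0) -> forall x, k x = 0.
Proof.
move=> [P nP E] rsu nrs k0 x; rewrite -E.
suff -> : P = 0 by rewrite horner0.
apply/eqP; apply: contraT => P0; have := max_poly_roots P0 _ rsu.
rewrite ltnNge (leq_trans nP nrs); apply.
by apply/allP => y yrs; rewrite /root E k0.
Qed.

(** * Hirota terms: the quartic times two Vandermonde products *)

Fixpoint double_vandermonde t : F :=
  if t is p :: t' then
    (\prod_(q <- t') ((p.1 - q.1) * (p.2 - q.2))) * double_vandermonde t'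
  else 1.

Definition power_diff (e : nat) t := \sum_(p <- t) (p.1 ^+ e - p.2 ^+ e).

Definition quartic_at t :=
  hirota_quartic (power_diff 1 t) (power_diff 2 t) (power_diff 3 t).

(* For the list t of the pairs (kappa_k, kappa_l), with k and l the i-th elements
   of the index sets of c and c', this is P_{cc'} a_c a_c' up to the lambda_i. *)
Definition hirota_term t := quartic_at t * double_vandermonde t.

Lemma hirota_term_exchange : exchange_invariant hirota_term.
Proof.
move=> l p q t; rewrite /hirota_term /quartic_at.
have pd e : power_diff e (l ++ p :: q :: t) = power_diff e (l ++ q :: p :: t).
  by apply: perm_big; rewrite perm_cat2l -(cat1s p) -(cat1s q) perm_catCA.
rewrite !pd; congr (_ * _); elim: l {pd} => [|r l IHl] /=.
  by rewrite !big_cons; ring.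
rewrite IHl; congr (_ * _); apply: perm_big.
by rewrite perm_cat2l -(cat1s p) -(cat1s q) perm_catCA.
Qed.

(** The pair [(z, z)] cancels from the power differences, and its Vandermonde factors are symmetric
    under flipping the other pairs. Its two orientations coincide, hence the factor 2. *)
Lemma orient_sum_equal z s :
  orient_sum hirota_term ((z, z) :: s) =
  2 * (\prod_(p <- s) ((z - p.1) * (z - p.2))) * orient_sum hirota_term s.
Proof.
rewrite -mulrA -orient_sum_prodl => [|p]; last by rewrite mulrC.
rewrite mulr_natl mulr2n /=; congr (_ + _); apply: eq_orient_sum => t _ /=;
  by rewrite /hirota_term /quartic_at /power_diff /= !big_cons !subrr !add0r;
     ring.
Qed.

(** Orientations with [z] twice on the same side have a zero Vandermonde factor. In the other two
    [z] cancels from the power differences, which leaves the pair [(y, x)] or its flip, and the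
    factors containing [z] are symmetric under flips of [s]. *)
Lemma orient_sum_merge z x y s :
  orient_sum hirota_term ((z, x) :: (z, y) :: s) =
  (z - y) * (x - z) * (\prod_(p <- s) ((z - p.1) * (z - p.2))) *
  orient_sum hirota_term ((y, x) :: s).
Proof.
pose c := (z - y) * (x - z); pose pz t := \prod_(p <- t) ((z - p.1) * (z - p.2)).
have E1 t : hirota_term [:: (z, x), (z, y) & t] = 0.
  by rewrite /hirota_term /= big_cons /= subrr !mul0r mulr0.
have E2 t : hirota_term [:: (x, z), (y, z) & t] = 0.
  by rewrite /hirota_term /= big_cons /= subrr mulr0 !mul0r mulr0.
have pzE a b t : (\prod_(q <- t) ((z - q.1) * (a - q.2))) *
    (\prod_(q <- t) ((b - q.1) * (z - q.2))) =
    pz t * \prod_(q <- t) ((b - q.1) * (a - q.2)).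
  by rewrite -!big_split; apply: eq_bigr => q _ /=; ring.
have E3 t : hirota_term [:: (z, x), (y, z) & t] =
    pz t * (c * hirota_term ((y, x) :: t)).
  rewrite /hirota_term /= big_cons /=.
  transitivity (quartic_at [:: (z, x), (y, z) & t] * c * (pz t *
     \prod_(q <- t) ((y - q.1) * (x - q.2))) * double_vandermonde t).
    by rewrite -pzE /c; ring.
  have -> : quartic_at [:: (z, x), (y, z) & t] = quartic_at ((y, x) :: t).
    by rewrite /quartic_at /power_diff !big_cons /=; congr hirota_quartic; ring.
  by ring.
have E4 t : hirota_term [:: (x, z), (z, y) & t] =
    pz t * (c * hirota_term ((x, y) :: t)).
  rewrite /hirota_term /= big_cons /=.
  transitivity (quartic_at [:: (x, z), (z, y) & t] * c * (pz t *
     \prod_(q <- t) ((x - q.1) * (y - q.2))) * double_vandermonde t).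
    by rewrite -pzE /c; ring.
  have -> : quartic_at [:: (x, z), (z, y) & t] = quartic_at ((x, y) :: t).
    by rewrite /quartic_at /power_diff !big_cons /=; congr hirota_quartic; ring.
  by ring.
have scale f' : orient_sum (fun t => pz t * (c * f' t)) s =
    c * pz s * orient_sum f' s.
  rewrite orient_sum_prodl => [|p]; last by rewrite mulrC.
  by rewrite orient_sumZ mulrCA mulrA.
rewrite /= (eq_orient_sum (h := fun=> 0)) => [|t _]; last by rewrite /= E1.
rewrite [X in _ + X + _](eq_orient_sum
  (h := fun t => pz t * (c * hirota_term ((y, x) :: t)))); last by move=> t _; apply: E3.
rewrite [X in _ + (X + _)](eq_orient_sum
  (h := fun t => pz t * (c * hirota_term ((x, y) :: t)))); last by move=> t _; apply: E4.
rewrite [X in _ + (_ + X)](eq_orient_sum (h := fun=> 0)); last by move=> t _; apply: E2.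
by rewrite !scale !orient_sum0 add0r addr0 -mulrDr.
Qed.

(* The coefficients of x ^+ 4 and x ^+ 3 in the quartic cancel. *)
Lemma bounded_poly_quartic (a b c : F) :
  bounded_poly 3 (fun x => hirota_quartic (x + a) (x ^+ 2 + b) (x ^+ 3 + c)).
Proof.
exists (Poly [:: a ^+ 4 + 3 * b ^+ 2 - 4 * a * c; 4 * a ^+ 3 - 4 * c;
                 6 * a ^+ 2 + 6 * b]) => [|x].
  exact: size_Poly.
by rewrite horner_Poly /= /hirota_quartic; ring.
Qed.

(** Degree 2 comes from the quartic and degree 1 from each pair of [t]; the bound is on the size,
    one more than the degree. *)
Lemma bounded_poly_hirota_term y t :
  bounded_poly (size t + 3) (fun x => hirota_term ((x, y) :: t)) /\
  bounded_poly (size t + 3) (fun x => hirota_term ((y, x) :: t)).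
Proof.
have lin (k : F -> F * F -> F) :
    (forall q, bounded_poly 2 (k ^~ q)) -> bounded_poly (size t).+1
      (fun x => (\prod_(q <- t) k x q) * double_vandermonde t).
  move=> kP.
  have cP : bounded_poly 1 (fun=> double_vandermonde t).
    exists (double_vandermonde t)%:P => [|x]; last by rewrite hornerC.
    by rewrite size_polyC; case: eqP.
  by have := bounded_polyM (bounded_poly_prod t kP) cP; rewrite addn0.
have fin (k1 k2 k : F -> F) : bounded_poly 3 k1 -> bounded_poly (size t).+1 k2 ->
    (forall x, k1 x * k2 x = k x) -> bounded_poly (size t + 3) k.
  move=> P1 P2 E; have [P nP PE] := bounded_polyM P1 P2.
  by exists P => [|x]; rewrite ?PE // addnC.
split.
  apply: fin (bounded_poly_quartic (power_diff 1 t - y)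
    (power_diff 2 t - y ^+ 2) (power_diff 3 t - y ^+ 3))
    (lin (fun x q => (x - q.1) * (y - q.2)) _) _ => [q|x].
    have [P nP E] := bounded_poly_affine 1 (- q.1) (y - q.2).
    by exists P => // x; rewrite E mul1r.
  rewrite /hirota_term /quartic_at /power_diff !big_cons /=; congr (_ * _).
  by congr hirota_quartic; ring.
apply: fin (bounded_poly_quartic (- power_diff 1 t - y)
  (- power_diff 2 t - y ^+ 2) (- power_diff 3 t - y ^+ 3))
  (lin (fun x q => (y - q.1) * (x - q.2)) _) _ => [q|x].
  have [P nP E] := bounded_poly_affine 1 (- q.2) (y - q.1).
  by exists P => // x; rewrite E mul1r mulrC.
rewrite /hirota_term /quartic_at /power_diff !big_cons /=; congr (_ * _).
by rewrite /hirota_quartic; ring.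
Qed.

Theorem orient_sum_hirota_term s : orient_sum hirota_term s = 0.
Proof.
have [n] := ubnP (size s); elim: n s => // n IHn s; rewrite ltnS => sn.
(* Each coincidence leaves a multiple of a sum with one pair fewer, zero by induction. *)
have coincident t : size t = size s -> ~~ uniq (endpoints t) ->
    orient_sum hirota_term t = 0.
  move=> ts /not_uniq_endpointsP[[z [r [tr ->]]]|[z [x [y [r [tr ->]]]]]];
    try exact: hirota_term_exchange.
    by rewrite orient_sum_equal IHn ?mulr0 //; move: sn; rewrite -ts tr.
  by rewrite orient_sum_merge IHn ?mulr0 //; move: sn; rewrite -ts tr.
(* With n pairs the sum has size at most n + 2 as a polynomial in [x], and the other numbers give 2n
   - 1 roots. This suffices only for n >= 3, so n = 0, 1, 2 are checked by expansion. *)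
case: s sn coincident => [_ _|[x y] [_ _|[x2 y2] [_ _|p3 s]]].
- by rewrite /= /hirota_term /quartic_at /power_diff !big_nil
    /hirota_quartic /=; ring.
- rewrite /= /hirota_term /quartic_at /power_diff !big_cons !big_nil
    /hirota_quartic /=; ring.
- rewrite /= /hirota_term /quartic_at /power_diff /= !big_cons !big_nil
    /hirota_quartic /=; ring.
have: (1 < size [:: (x2, y2), p3 & s])%N by [].
move: (_ :: p3 :: s) => s' s'2 sn coincident.
(* A repetition among the numbers other than [x] already gives zero, whatever [x] is. *)
have [us|us] := boolP (uniq (y :: endpoints s')); last first.
  by apply: coincident => //; apply: contra us => /= /and3P[_ -> ->].
have termP : bounded_poly (size s' + 3)
    (fun x => orient_sum (hirota_term \o cons (x, y)) s').
  apply: bounded_poly_orient_sum => t <-.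
  by have [] := bounded_poly_hirota_term y t.
have termP' : bounded_poly (size s' + 3)
    (fun x => orient_sum (hirota_term \o cons (y, x)) s').
  apply: bounded_poly_orient_sum => t <-.
  by have [] := bounded_poly_hirota_term y t.
apply: (bounded_poly_eq0 (bounded_polyD termP termP') us) => [|z zs].
  by rewrite /= size_endpoints addnC mul2n -addnn -addSn leq_add2r.
by apply: (coincident ((z, y) :: s')) => //=; rewrite zs.
Qed.

End Orientations.

(** * Weighted homogeneous polynomials and Hirota's equations *)

Section WeightedHomogeneous.
Variables (R : realType) (g : nat).
Local Notation C := R[i].
Local Notation cpoly := (cpoly R g).
Implicit Types (f h : cpoly) (a : {ffun cube g -> C}) (x : 'M[C]_(3, g)).

Definition wdeg (m : 'X_{1..#|{: hcoord g}|}) : nat :=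
  \sum_(k : hcoord g) coord_deg k * m (enum_rank k).

Definition whomog_deg (d : nat) f := forall m, m \in msupp f -> wdeg m = d.

Lemma whomog_degD d f h :
  whomog_deg d f -> whomog_deg d h -> whomog_deg d (f + h).
Proof.
by move=> fP hP m /msuppD_le; rewrite mem_cat => /orP[/fP|/hP].
Qed.

Lemma whomog_degN d f : whomog_deg d f -> whomog_deg d (- f).
Proof. by move=> fP m; rewrite (perm_mem (msuppN f)); apply: fP. Qed.

Lemma whomog_deg0 d : whomog_deg d 0.
Proof. by move=> m; rewrite msupp0. Qed.

Lemma whomog_degC c : whomog_deg 0 c%:MP.
Proof.
move=> m; rewrite msuppC; case: eqP => // _; rewrite inE => /eqP->.
by apply: big1 => k _; rewrite mnm0E muln0.
Qed.

Lemma whomog_degM d e f h :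
  whomog_deg d f -> whomog_deg e h -> whomog_deg (d + e) (f * h).
Proof.
move=> fP hP m /msuppM_le /allpairsP[[m1 m2] [/fP <- /hP <- ->]].
by rewrite /wdeg -big_split; apply: eq_bigr => k _; rewrite mnmDE mulnDr.
Qed.

Lemma whomog_degX n d f : whomog_deg d f -> whomog_deg (d * n) (f ^+ n).
Proof.
move=> fP; elim: n => [|n IHn]; first by rewrite muln0 expr0 -mpolyC1; apply: whomog_degC.
by rewrite mulnS exprS; apply: whomog_degM.
Qed.

Lemma whomog_deg_cvar k : whomog_deg (coord_deg k) (cvar R k).
Proof.
move=> m; rewrite msuppX inE => /eqP->; rewrite /wdeg (bigD1 k) //= big1 => [|l kl].
  by rewrite mnm1E eqxx muln1 addn0.
by rewrite mnm1E (inj_eq enum_rank_inj) eq_sym (negbTE kl) muln0.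
Qed.

Lemma whomog_deg_sum (T : Type) (r : seq T) (P : pred T) (F : T -> cpoly) d :
  (forall i, P i -> whomog_deg d (F i)) -> whomog_deg d (\sum_(i <- r | P i) F i).
Proof.
by move=> FP; apply: big_ind => //; [apply: whomog_deg0 | apply: whomog_degD].
Qed.

Lemma whomogM f h : whomog f -> whomog h -> whomog (f * h).
Proof.
by move=> [d fP] [e hP]; exists (d + e)%N; apply: whomog_degM.
Qed.

Lemma whomog_prod (T : Type) (r : seq T) (P : pred T) (F : T -> cpoly) :
  (forall i, P i -> whomog (F i)) -> whomog (\prod_(i <- r | P i) F i).
Proof.
move=> FP; apply: big_ind => //; last exact: whomogM.
by exists 0%N; rewrite -mpolyC1; apply: whomog_degC.
Qed.

Definition coord_at a x (k : hcoord g) : C :=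
  match k with inl c => a c | inr (e, i) => x e i end.

Lemma meval_cvar a x k : (cvar R k).@[coord_val a x] = coord_at a x k.
Proof. by rewrite mevalXU /coord_val enum_rankK. Qed.

Lemma meval_wscale d f a t x : whomog_deg d f ->
  f.@[coord_val a (wscale t x)] = t ^+ d * f.@[coord_val a x].
Proof.
move=> fP; rewrite !mevalE mulr_sumr; apply: eq_big_seq => m /fP dm.
rewrite mulrCA; congr (_ * _).
rewrite !(reindex _ (onW_bij _ (enum_rank_bij (hcoord g)))) /=.
rewrite -dm expr_sum -big_split; apply: eq_bigr => k _ /=.
rewrite exprM -exprMn; congr (_ ^+ _); rewrite /coord_val enum_rankK.
by case: k => [c|[e i]] /=; rewrite ?mul1r // mxE.
Qed.

Lemma wproj_eqP (x y : punctured R g) :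
  \pi_(wproj R g)%qT x = \pi_(wproj R g)%qT y ->
  exists2 t : C, t != 0 & val y = wscale t (val x).
Proof. by move/eqmodP/asboolP. Qed.

(** Changing the representative multiplies the value by a power of the scalar, so a single
    representative decides vanishing. *)
Lemma vanishes_atP f (p : ambient R g) (x : punctured R g) :
  whomog f -> \pi_(wproj R g)%qT x = p.2 ->
  vanishes_at f p <-> f.@[coord_val (val p.1) (val x)] = 0.
Proof.
move=> [d fP] xp; split=> [|fx y yp]; first by apply.
have /wproj_eqP[t _ ->] : \pi_(wproj R g)%qT x = \pi_(wproj R g)%qT y by rewrite xp.
by rewrite (meval_wscale _ _ _ fP) fx mulr0.
Qed.

End WeightedHomogeneous.

(** * The Hirota equations at a point *)

Lemma rmorph_hirota_quartic (A B : comNzRingType) (k : {rmorphism A -> B})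
    (x y t : A) :
  k (hirota_quartic x y t) = hirota_quartic (k x) (k y) (k t).
Proof.
rewrite /hirota_quartic rmorphB rmorphD rmorphXn (rmorphM _ 3) rmorphXn.
by rewrite (rmorphM _ (4 * x)) (rmorphM _ 4) !rmorph_nat.
Qed.

Section HirotaEquations.
Variables (R : realType) (g : nat).
Local Notation C := R[i].
Implicit Types (c : cube g) (a : {ffun cube g -> C}) (x : 'M[C]_(3, g)).
Implicit Type (d : 'rV[int]_g).

Definition cube_dot x c c' (e : 'I_3) : C :=
  \sum_i ((cube_vec c - cube_vec c') 0 i)%:~R * x e i.

Definition hirota_val x c c' : C :=
  hirota_quartic (cube_dot x c c' 0) (cube_dot x c c' 1) (cube_dot x c c' 2).

Lemma meval_hirota_P a x c c' :
  (hirota_P R c c').@[coord_val a x] = hirota_val x c c'.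
Proof.
have dotE e : (\sum_i ((cube_vec c - cube_vec c') 0 i)%:~R *
    cvar R (inr (e, i))).@[coord_val a x] = cube_dot x c c' e.
  rewrite rmorph_sum; apply: eq_bigr => i _ /=.
  by rewrite rmorphM rmorph_int /= meval_cvar.
by rewrite rmorph_hirota_quartic /= !dotE.
Qed.

Lemma hirota_val_sym x c c' : hirota_val x c' c = hirota_val x c c'.
Proof.
have dotN e : cube_dot x c' c e = - cube_dot x c c' e.
  rewrite /cube_dot -sumrN; apply: eq_bigr => i _.
  by rewrite -opprB mxE rmorphN mulNr.
by rewrite /hirota_val !dotN /hirota_quartic; ring.
Qed.

Lemma hirota_val_diag x c : hirota_val x c c = 0.
Proof.
have dot0 e : cube_dot x c c e = 0.
  by apply: big1 => i _; rewrite subrr mxE mul0r.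
by rewrite /hirota_val !dot0 /hirota_quartic; ring.
Qed.

(** Both orders of a pair and the diagonal pairs are included, so that the set is stable under
    swapping single coordinates. The diagonal contributes zero because the quartic vanishes at the
    origin. *)
Definition ordered_pairs d : {set cube g * cube g} :=
  [set q | cube_vec q.1 + cube_vec q.2 == d].

Lemma sum_ordered_pairs d (h : cube g * cube g -> C) :
  (forall c c', h (c', c) = h (c, c')) -> (forall c, h (c, c) = 0) ->
  \sum_(q in ordered_pairs d) h q = 2 * \sum_(q in pairs_of_sum d) h q.
Proof.
move=> hC h0; rewrite (bigID (fun q => enum_rank q.1 < enum_rank q.2)%N) /=.
rewrite mulr_natl mulr2n; congr (_ + _).
  by apply: eq_bigl => q; rewrite !inE andbC.
pose sw (q : cube g * cube g) := (q.2, q.1).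
have swK : involutive sw by case.
rewrite [RHS](reindex_inj (can_inj swK)) /=.
rewrite (bigID (fun q => enum_rank q.2 < enum_rank q.1)%N) /= addrC big1 ?add0r.
  apply: eq_big => [q|[c c'] _]; last by rewrite hC.
  rewrite !inE /= [cube_vec q.2 + _]addrC -leqNgt.
  by case: ltngtP; rewrite ?andbF ?andbT.
move=> [c c'] /andP[/andP[_]]; rewrite -!leqNgt /= => h1 h2.
suff -> : c = c' by [].
by apply/enum_rank_inj/val_inj/anti_leq; rewrite h1 h2.
Qed.

(** The two cases of [hirota_poly] become uniform: the monomial omitted for a single pair is nonzero
    on the torus, and passing to ordered pairs only doubles the sum. *)
Lemma meval_hirota_poly_eq0 a x d : (forall c, a c != 0) ->
  (hirota_poly R d).@[coord_val a x] = 0 <->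
  \sum_(q in ordered_pairs d) hirota_val x q.1 q.2 * (a q.1 * a q.2) = 0.
Proof.
move=> a0; rewrite sum_ordered_pairs => [|c c'|c]; first last.
- by rewrite /= hirota_val_diag mul0r.
- by rewrite /= hirota_val_sym [a c' * _]mulrC.
have two0 : 2 != 0 :> C by rewrite pnatr_eq0.
rewrite /hirota_poly; case: eqP => [/eqP/cards1P[q ->]|_].
  rewrite !big_set1 meval_hirota_P; split=> [->|]; first by rewrite mul0r mulr0.
  by move/eqP; rewrite !mulf_eq0 !(negbTE (a0 _)) (negbTE two0) !orbF => /eqP.
rewrite rmorph_sum (eq_bigr (fun q => hirota_val x q.1 q.2 * (a q.1 * a q.2))).
  split=> [->|]; first by rewrite mulr0.
  by move/eqP; rewrite mulf_eq0 (negbTE two0) => /eqP.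
by move=> q _; rewrite !rmorphM /= meval_hirota_P !meval_cvar mulrA.
Qed.

Lemma whomog_hirota_poly d : whomog (hirota_poly R d).
Proof.
have Z0 (z : int) : whomog_deg 0 (z%:~R : cpoly R g).
  by rewrite -(rmorph_int (@mpolyC _ _)); apply: whomog_degC.
have dotP c c' (e : 'I_3) : whomog_deg e.+1
    (\sum_i ((cube_vec c - cube_vec c') 0 i)%:~R * cvar R (inr (e, i))).
  apply: whomog_deg_sum => i _.
  exact: (whomog_degM (Z0 _) (@whomog_deg_cvar R g (inr (e, i)))).
have PP c c' : whomog_deg 4 (hirota_P R c c').
  have nat0 n : whomog_deg 0 (n%:R : cpoly R g) by apply: (Z0 n).
  apply: whomog_degD; last apply: whomog_degN.
    apply: whomog_degD; first exact: (whomog_degX (n := 4) (dotP c c' 0)).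
    exact: (whomog_degM (nat0 3) (whomog_degX (n := 2) (dotP c c' 1))).
  exact: (whomog_degM (whomog_degM (nat0 4) (dotP c c' 0)) (dotP c c' 2)).
exists 4%N; rewrite /hirota_poly; case: ifP => _; apply: whomog_deg_sum => q _ //.
exact: (whomog_degM (whomog_degM (PP q.1 q.2)
  (@whomog_deg_cvar R g (inl q.1))) (@whomog_deg_cvar R g (inl q.2))).
Qed.

Lemma hirota_varietyP (p : ambient R g) (x : punctured R g) :
  \pi_(wproj R g)%qT x = p.2 ->
  hirota_variety R g p <-> forall d, distinct_sum d ->
    \sum_(q in ordered_pairs d) hirota_val (val x) q.1 q.2 *
      (val p.1 q.1 * val p.1 q.2) = 0.
Proof.
move=> xp; have p0 c : val p.1 c != 0 by move/forallP: (valP p.1); apply.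
have E d := vanishes_atP (whomog_hirota_poly d) xp.
split=> [pH d dd|pH _ [d dd <-]].
  by apply/meval_hirota_poly_eq0/E => //; apply: pH; exists d.
by apply/E/meval_hirota_poly_eq0 => //; apply: pH.
Qed.

Lemma zariski_closed_hirota_variety : zariski_closed (hirota_variety R g).
Proof.
by exists [set hirota_poly R d | d in @distinct_sum g]%classic => // _ [d _ <-];
  apply: whomog_hirota_poly.
Qed.

End HirotaEquations.

(** * Points in the image of phi *)

Lemma double_vandermonde_enum (F : idomainType) n (h : 'I_n -> F * F) :
  double_vandermonde [seq h i | i <- enum 'I_n] =
  \prod_(i < n) \prod_(j < n | (i < j)%N)
    (((h i).1 - (h j).1) * ((h i).2 - (h j).2)).
Proof.
elim: n h => [|n IHn] h; first by rewrite enum_ord0 big_ord0.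
rewrite enum_ordSl /= -map_comp IHn big_ord_recl; congr (_ * _).
  rewrite big_map big_enum [RHS]big_mkcond big_ord_recl /= mul1r.
  by apply: eq_bigr.
apply: eq_bigr => i _; rewrite [RHS]big_mkcond big_ord_recl /= mul1r.
by rewrite big_mkcond.
Qed.

Section ParametrizedPoints.
Variables (R : realType) (g : nat).
Local Notation C := R[i].
Variables (lambda : 'I_g -> C) (kappa : 'I_(2 * g) -> C).
Implicit Types (c : cube g) (q : cube g * cube g) (r : seq 'I_g).
Implicit Type (d : 'rV[int]_g).

Lemma kappa_index_inj c : injective (fun i : 'I_g => kappa_index i (c i)).
Proof.
move=> i j /(congr1 (fun k : 'I__ => k./2)) /=.
by rewrite !mul2n [(_.*2 + _)%N]addnC [(j.*2 + _)%N]addnC !half_bit_double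
  => /val_inj.
Qed.

(** Each [i] owns a block of two consecutive indices, so the order between blocks ignores [b] and
    [b']. *)
Lemma ltn_kappa_index (i j : 'I_g) b b' : i != j ->
  (kappa_index i b < kappa_index j b')%N = (i < j)%N.
Proof.
rewrite -val_eqE /= neq_ltn => /orP[ij|ji].
  rewrite ij; apply: leq_trans (leq_addr _ _).
  rewrite -addnS; apply: (@leq_trans (2 * i.+1)); last by rewrite leq_mul2l ij.
  by rewrite mulnS addnC leq_add2r; case: b.
rewrite [RHS]ltnNge (ltnW ji) /=; apply/negbTE; rewrite -leqNgt.
apply: leq_trans (leq_addr _ _).
apply: (@leq_trans (2 * j.+1)); last by rewrite leq_mul2l ji.
by rewrite mulnS addnC leq_add2r; case: b'.
Qed.

Lemma phi_aE c : phi_a lambda kappa c =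
  (\prod_(i < g) \prod_(j < g | (i < j)%N)
     (kappa (kappa_index i (c i)) - kappa (kappa_index j (c j)))) *
  \prod_(i | c i) lambda i.
Proof.
rewrite /phi_a; congr (_ * _).
have inj : {in predT &, injective (fun i : 'I_g => kappa_index i (c i))}.
  by move=> i j _ _; apply: kappa_index_inj.
rewrite /index_set (big_imset _ inj) /=; apply: eq_bigr => i _.
rewrite big_imset_cond //=.
apply: eq_bigl => j.
have [->|ij] := eqVneq i j; first by rewrite !ltnn.
by rewrite ltn_kappa_index.
Qed.

Definition kappa_pair q i :=
  (kappa (kappa_index i (q.1 i)), kappa (kappa_index i (q.2 i))).

Definition kappa_pairs r q := [seq kappa_pair q i | i <- r].

Definition flip_at i q : cube g * cube g :=
  ([ffun j => if j == i then q.2 j else q.1 j],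
   [ffun j => if j == i then q.1 j else q.2 j]).

Lemma flip_atK i : involutive (flip_at i).
Proof.
by case=> c c'; congr pair; apply/ffunP => j; rewrite !ffunE; case: eqP.
Qed.

Lemma flip_at_ordered_pairs i d q :
  (flip_at i q \in ordered_pairs d) = (q \in ordered_pairs d).
Proof.
rewrite !inE; congr (_ == d); apply/rowP => j; rewrite !mxE /= !ffunE.
by case: eqP => _ //; rewrite addrC.
Qed.

(* Flipping q at i permutes the ordered pairs of sum d, so each orientation of
   kappa_pairs r q contributes the same total. *)
Lemma sum_orient_sum d r (f : cube g * cube g -> seq (C * C) -> C) : uniq r ->
  (forall i q, i \in r -> f (flip_at i q) = f q) ->
  2 ^+ size r * \sum_(q in ordered_pairs d) f q (kappa_pairs r q) =
  \sum_(q in ordered_pairs d) orient_sum (f q) (kappa_pairs r q).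
Proof.
elim: r f => [|i r IHr] f /=; first by move=> _ _; rewrite mul1r.
move=> /andP[ir ru] fflip; rewrite big_split /=.
have flip_head q : kappa_pair (flip_at i q) i = flip (kappa_pair q i).
  by rewrite /kappa_pair /= !ffunE eqxx.
have flip_tail q : kappa_pairs r (flip_at i q) = kappa_pairs r q.
  apply/eq_in_map => j jr; have ji : j != i by apply: contraNneq ir => <-.
  by rewrite /kappa_pair /= !ffunE (negbTE ji).
rewrite [X in _ + X](reindex_inj (can_inj (flip_atK i))) /=.
rewrite [X in _ + X](eq_big (mem (ordered_pairs d))
  (fun q => orient_sum (f q \o cons (kappa_pair q i)) (kappa_pairs r q))).
- rewrite -IHr // => [|j q jr]; last first.
    have ij : i != j by apply: contraNneq ir => ->.
    rewrite fflip ?inE ?jr ?orbT //; congr (_ \o cons _).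
    by rewrite /kappa_pair /= !ffunE (negbTE ij).
  by rewrite exprS mulrDl mul1r mulrDl.
- by move=> q; rewrite flip_at_ordered_pairs.
- by move=> q _; rewrite flip_head flip_tail fflip ?inE ?eqxx //; case: (kappa_pair q i).
Qed.

Lemma cube_dot_phi_uvw c c' (e : 'I_3) :
  cube_dot (phi_uvw kappa) c c' e =
  power_diff e.+1 (kappa_pairs (enum 'I_g) (c, c')).
Proof.
rewrite /power_diff /kappa_pairs big_map big_enum; apply: eq_bigr => i _ /=.
by rewrite !mxE; case: (c i) (c' i) => [] [] /=; ring.
Qed.

(** The exponent of [lambda i] is the sum of the two i-th coordinates, which is [d 0 i]; hence the
    lambda factor is common to all pairs of sum [d]. *)
Lemma phi_aM d q : q \in ordered_pairs d ->
  phi_a lambda kappa q.1 * phi_a lambda kappa q.2 =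
  double_vandermonde (kappa_pairs (enum 'I_g) q) *
  \prod_i lambda i ^+ absz (d 0 i).
Proof.
rewrite inE => /eqP dq; rewrite !phi_aE double_vandermonde_enum mulrACA.
congr (_ * _).
  by rewrite -big_split; apply: eq_bigr => i _; rewrite -big_split.
rewrite [X in X * _]big_mkcond [X in _ * X]big_mkcond -big_split.
apply: eq_bigr => i _ /=; rewrite -dq !mxE.
by case: (q.1 i) (q.2 i) => [] []; rewrite /= ?mulr1 ?mul1r ?expr2 ?expr1.
Qed.

Lemma sum_hirota_phi d :
  \sum_(q in ordered_pairs d) hirota_val (phi_uvw kappa) q.1 q.2 *
    (phi_a lambda kappa q.1 * phi_a lambda kappa q.2) = 0.
Proof.
pose Lambda := \prod_i lambda i ^+ absz (d 0 i).
transitivity (Lambda * \sum_(q in ordered_pairs d)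
    hirota_term (kappa_pairs (enum 'I_g) q)).
  rewrite mulr_sumr; apply: eq_bigr => q dq; rewrite (phi_aM dq) -/Lambda.
  rewrite /hirota_val !cube_dot_phi_uvw -surjective_pairing /hirota_term.
  by rewrite mulrA mulrC.
(* Summing over orientations repeats the sum 2^g times, a factor that can be cancelled. *)
have two0 : 2 ^+ size (enum 'I_g) != 0 :> C by rewrite expf_neq0 // pnatr_eq0.
rewrite [X in _ * X](_ : _ = 0) ?mulr0 //; apply: (mulfI two0).
rewrite mulr0 (@sum_orient_sum d (enum 'I_g) (fun=> @hirota_term C));
  rewrite ?enum_uniq //.
by apply: big1 => q _; apply: orient_sum_hirota_term.
Qed.

Lemma phi_graph_hirota_variety p :
  phi_graph lambda kappa p -> hirota_variety R g p.
Proof.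
move=> [pa [x xE px]]; apply/(hirota_varietyP (esym px)) => d _.
rewrite xE -[RHS](sum_hirota_phi d); apply: eq_bigr => q _.
by rewrite !pa.
Qed.

End ParametrizedPoints.

(** * Irreducibility of the main component *)

Section PolynomialFunctions.
Variable F : numFieldType.
Implicit Types k : F -> F.

Definition poly_fun k := exists P : {poly F}, forall t, P.[t] = k t.

Lemma poly_fun_const c : poly_fun (fun=> c).
Proof. by exists c%:P => t; rewrite hornerC. Qed.

Lemma poly_funM k1 k2 :
  poly_fun k1 -> poly_fun k2 -> poly_fun (fun t => k1 t * k2 t).
Proof. by move=> [P1 E1] [P2 E2]; exists (P1 * P2) => t; rewrite hornerM E1 E2. Qed.

Lemma poly_funB k1 k2 :
  poly_fun k1 -> poly_fun k2 -> poly_fun (fun t => k1 t - k2 t).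
Proof.
by move=> [P1 E1] [P2 E2]; exists (P1 - P2) => t; rewrite hornerD hornerN E1 E2.
Qed.

Lemma poly_funX k n : poly_fun k -> poly_fun (fun t => k t ^+ n).
Proof. by move=> [P E]; exists (P ^+ n) => t; rewrite horner_exp E. Qed.

Lemma poly_fun_sum (T : Type) (r : seq T) (A : pred T) (k : T -> F -> F) :
  (forall i, poly_fun (k i)) -> poly_fun (fun t => \sum_(i <- r | A i) k i t).
Proof.
move=> kP; elim: r => [|i r [P E]].
  by exists 0 => t; rewrite big_nil horner0.
have [Q EQ] := kP i; exists (if A i then Q + P else P) => t.
by rewrite big_cons; case: ifP => _; rewrite ?hornerD ?EQ E.
Qed.

Lemma poly_fun_prod (T : Type) (r : seq T) (A : pred T) (k : T -> F -> F) :
  (forall i, poly_fun (k i)) -> poly_fun (fun t => \prod_(i <- r | A i) k i t).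
Proof.
move=> kP; elim: r => [|i r [P E]].
  by exists 1 => t; rewrite big_nil hornerC.
have [Q EQ] := kP i; exists (if A i then Q * P else P) => t.
by rewrite big_cons; case: ifP => _; rewrite ?hornerM ?EQ E.
Qed.

Lemma poly_fun_affine a b : poly_fun (fun t => a + t * b).
Proof. by exists (a%:P + 'X * b%:P) => t; rewrite !hornerE. Qed.

Lemma poly_fun_meval n (f : {mpoly F[n]}) (v : 'I_n -> F -> F) :
  (forall i, poly_fun (v i)) -> poly_fun (fun t => f.@[fun i => v i t]).
Proof.
move=> vP.
have [P E] : poly_fun (fun t =>
    \sum_(m <- msupp f) f@_m * \prod_(i < n) v i t ^+ m i).
  apply: poly_fun_sum => m; apply: poly_funM; first exact: poly_fun_const.
  by apply: poly_fun_prod => i; apply: poly_funX.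
by exists P => t; rewrite E mevalE.
Qed.

Lemma common_nonroot (T : eqType) (r : seq T) (k : T -> F -> F) :
  (forall i, i \in r -> poly_fun (k i) /\ exists t, k i t != 0) ->
  exists t, forall i, i \in r -> k i t != 0.
Proof.
move=> kP.
have [P P0 PE] : exists2 P : {poly F}, P != 0 &
    forall i t, i \in r -> P.[t] != 0 -> k i t != 0.
  elim: r kP => [|i r IHr] kP; first by exists 1; rewrite ?oner_neq0.
  have [|P P0 PE] := IHr; first by move=> j jr; apply: kP; rewrite inE jr orbT.
  have [[Q QE] [t kt]] := kP i (mem_head _ _).
  have Q0 : Q != 0 by apply: contraNneq kt => Q0; rewrite -QE Q0 horner0.
  exists (Q * P) => [|j s]; first by rewrite mulf_neq0.
  rewrite hornerM mulf_eq0 negb_or inE => /orP[/eqP-> /andP[]|jr /andP[_]].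
    by rewrite QE.
  exact: PE.
(* One more natural number than the degree of [P], all distinct in characteristic zero, so one of
   them is not a root. *)
pose rs := [seq n%:R : F | n <- iota 0 (size P)].
have rsu : uniq rs.
  by rewrite map_inj_uniq ?iota_uniq // => m n /eqP; rewrite eqr_nat => /eqP.
have [/allP rsP|/allPn[t _ Pt]] := boolP (all (root P) rs).
  by have := max_poly_roots P0 (introT allP rsP) rsu; rewrite size_map size_iota ltnn.
by exists t => i ir; apply: PE.
Qed.

End PolynomialFunctions.

(** * The image of phi and its closure *)

Section PhiImage.
Variables (R : realType) (g : nat).
Local Notation C := R[i].
Implicit Types (lambda : 'I_g -> C) (kappa : 'I_(2 * g) -> C).
Implicit Types (p : ambient R g) (f h : cpoly R g).

Definition phi_image : set (ambient R g) :=
  [set p | exists lambda kappa, phi_graph lambda kappa p]%classic.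

Lemma phi_graph_exists lambda kappa : (forall c, phi_a lambda kappa c != 0) ->
  phi_uvw kappa != 0 -> exists p, phi_graph lambda kappa p.
Proof.
move=> a0 x0.
have a0' : [forall c, [ffun c => phi_a lambda kappa c] c != 0].
  by apply/forallP => c; rewrite ffunE.
exists (Sub [ffun c => phi_a lambda kappa c] a0' : torus R g,
        \pi_(wproj R g)%qT (Sub (phi_uvw kappa) x0 : punctured R g)).
split=> [c|]; first by rewrite SubK ffunE.
by exists (Sub (phi_uvw kappa) x0).
Qed.

Definition eval_phi f lambda kappa : C :=
  f.@[coord_val [ffun c => phi_a lambda kappa c] (phi_uvw kappa)].

Lemma vanishes_at_phi f lambda kappa p : whomog f ->
  phi_graph lambda kappa p -> vanishes_at f p <-> eval_phi f lambda kappa = 0.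
Proof.
move=> fP [pa [x xE px]]; rewrite /eval_phi -xE.
have -> : [ffun c => phi_a lambda kappa c] = val p.1.
  by apply/ffunP => c; rewrite ffunE pa.
exact: vanishes_atP.
Qed.

Lemma poly_fun_phi_a (lambda : 'I_g -> C -> C) (kappa : 'I_(2 * g) -> C -> C) c :
  (forall i, poly_fun (lambda i)) -> (forall i, poly_fun (kappa i)) ->
  poly_fun (fun t => phi_a (lambda ^~ t) (kappa ^~ t) c).
Proof.
move=> lP kP; apply: poly_funM; last exact: poly_fun_prod.
by apply: poly_fun_prod => i; apply: poly_fun_prod => j; apply: poly_funB.
Qed.

Lemma poly_fun_phi_uvw (kappa : 'I_(2 * g) -> C -> C) e i :
  (forall i, poly_fun (kappa i)) ->
  poly_fun (fun t => phi_uvw (kappa ^~ t) e i).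
Proof.
move=> kP; have [P E] : poly_fun (fun t => kappa (kappa_index i true) t ^+ e.+1 -
    kappa (kappa_index i false) t ^+ e.+1).
  by apply: poly_funB; apply: poly_funX.
by exists P => t; rewrite E mxE.
Qed.

Lemma poly_fun_eval_phi f (lambda : 'I_g -> C -> C)
    (kappa : 'I_(2 * g) -> C -> C) :
  (forall i, poly_fun (lambda i)) -> (forall i, poly_fun (kappa i)) ->
  poly_fun (fun t => eval_phi f (lambda ^~ t) (kappa ^~ t)).
Proof.
move=> lP kP; apply: (@poly_fun_meval _ _ f (fun k t => coord_val
  [ffun c => phi_a (lambda ^~ t) (kappa ^~ t) c] (phi_uvw (kappa ^~ t)) k)).
move=> k; rewrite /coord_val; case: (enum_val k) => [c|[e i]].
  have [P E] := poly_fun_phi_a c lP kP.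
  by exists P => t; rewrite E ffunE.
exact: poly_fun_phi_uvw.
Qed.

(* Two points of the image are joined by the image of a line, along which
   conditions of the form f != 0 fail only finitely often. *)
Lemma phi_image_generic f1 f2 p1 p2 : whomog f1 -> whomog f2 ->
  phi_image p1 -> phi_image p2 -> ~ vanishes_at f1 p1 -> ~ vanishes_at f2 p2 ->
  exists p, [/\ phi_image p, ~ vanishes_at f1 p & ~ vanishes_at f2 p].
Proof.
move=> w1 w2 [l1 [k1 G1]] [l2 [k2 G2]].
move=> /(vanishes_at_phi w1 G1) /eqP v1 /(vanishes_at_phi w2 G2) /eqP v2.
pose l i t := l1 i + t * (l2 i - l1 i); pose k i t := k1 i + t * (k2 i - k1 i).
have lP i : poly_fun (l i) by apply: poly_fun_affine.
have kP i : poly_fun (k i) by apply: poly_fun_affine.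
have l0 : l ^~ 0 = l1 by apply/funext => i; rewrite /l mul0r addr0.
have k0 : k ^~ 0 = k1 by apply/funext => i; rewrite /k mul0r addr0.
have l1E : l ^~ 1 = l2 by apply/funext => i; rewrite /l mul1r addrC subrK.
have k1E : k ^~ 1 = k2 by apply/funext => i; rewrite /k mul1r addrC subrK.
have [pa1 [x1 xE1 _]] := G1.
have [e [i ei0]] : exists e i, phi_uvw k1 e i != 0.
  apply: contrapT => x0; have /eqP := valP x1; apply; rewrite xE1.
  apply/matrixP => e i; rewrite [RHS]mxE; apply/eqP; apply: contrapT => /negP ei.
  by apply: x0; exists e, i.
(* One index type collects the conditions on [t]: nonvanishing of [f1], of [f2], of one entry of
   [phi_uvw], and of every [phi_a]. The condition on [f2] holds at [t = 1], all the others at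
   [t = 0]. *)
pose K (s : option (option (option (cube g)))) t := match s with
  | None => eval_phi f1 (l ^~ t) (k ^~ t)
  | Some None => eval_phi f2 (l ^~ t) (k ^~ t)
  | Some (Some None) => phi_uvw (k ^~ t) e i
  | Some (Some (Some c)) => phi_a (l ^~ t) (k ^~ t) c
  end.
have [|t tP] := common_nonroot (r := enum {: option (option (option (cube g)))})
    (k := K).
  case=> [[[c|]|]|] _; split.
  - exact: poly_fun_phi_a.
  - exists 0; rewrite /= l0 k0 -pa1; have /forallP := valP p1.1; exact.
  - exact: poly_fun_phi_uvw.
  - by exists 0; rewrite /= k0.
  - exact: poly_fun_eval_phi.
  - by exists 1; rewrite /= l1E k1E; exact: v2.
  - exact: poly_fun_eval_phi.
  - by exists 0; rewrite /= l0 k0; exact: v1.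
have [c||p Gp] := @phi_graph_exists (l ^~ t) (k ^~ t).
- by apply: (tP (Some (Some (Some c)))); rewrite mem_enum.
- apply: contraNneq (tP (Some (Some None)) (mem_enum _ _)) => /= ->.
  by rewrite mxE.
exists p; split; first by exists (l ^~ t), (k ^~ t).
- by move/(vanishes_at_phi w1 Gp)/eqP; apply/negP/(tP None); rewrite mem_enum.
- by move/(vanishes_at_phi w2 Gp)/eqP; apply/negP/(tP (Some None)); rewrite mem_enum.
Qed.

Lemma not_zerosP (S : set (cpoly R g)) p :
  ~ zeros S p -> exists2 f, S f & ~ vanishes_at f p.
Proof.
move=> /existsNP[f /not_implyP[Sf fp]]; by exists f.
Qed.

(** Otherwise an equation of [A] and an equation of [B] each fail somewhere on the image, hence both
    fail at a common point of it, which lies outside the union. *)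
Lemma phi_image_irreducible A B : zariski_closed A -> zariski_closed B ->
  (phi_image `<=` A `|` B -> phi_image `<=` A \/ phi_image `<=` B)%classic.
Proof.
move=> [S SP ->] [T TP ->] sub; apply: contrapT => /not_orP[].
move=> /existsNP[p1 /not_implyP[i1 /not_zerosP[f1 S1 v1]]].
move=> /existsNP[p2 /not_implyP[i2 /not_zerosP[f2 T2 v2]]].
have [p [/sub[] pP n1 n2]] :=
  phi_image_generic (SP _ S1) (TP _ T2) i1 i2 v1 v2.
- exact/n1/pP.
- exact/n2/pP.
Qed.

Lemma phi_image_sub_closure : (phi_image `<=` main_component R g)%classic.
Proof. by move=> p pI Z [_]; apply. Qed.

Lemma main_component_min Z : zariski_closed Z ->
  (phi_image `<=` Z -> main_component R g `<=` Z)%classic.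
Proof. by move=> cZ iZ p; apply. Qed.

Lemma main_component_irreducible : (phi_image !=set0)%classic ->
  irreducible_set (main_component R g).
Proof.
move=> [p pI]; split; first by exists p; apply: phi_image_sub_closure.
move=> A B cA cB sub; have [] := phi_image_irreducible cA cB.
- by move=> q /phi_image_sub_closure/sub.
- by left; apply: main_component_min.
- by right; apply: main_component_min.
Qed.

Lemma main_component_sub_hirota :
  (main_component R g `<=` hirota_variety R g)%classic.
Proof.
apply: main_component_min; first exact: zariski_closed_hirota_variety.
by move=> p [lambda [kappa]]; apply: phi_graph_hirota_variety.
Qed.

End PhiImage.

(** * Reconstruction of parameters from edges and squares *)

Section Faces.
Variable g : nat.
Implicit Types (c : cube g) (i j k : 'I_g) (q : cube g * cube g).

Definition set_coord c i b : cube g := [ffun k => if k == i then b else c k].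

Lemma mem_ordered_pairs c1 c2 q :
  (q \in ordered_pairs (cube_vec c1 + cube_vec c2)) =
  [forall k, q.1 k + q.2 k == c1 k + c2 k]%N.
Proof.
rewrite inE; apply/eqP/forallP => [E k|E].
  by move/rowP/(_ k): E; rewrite !mxE -!PoszD => -[->].
by apply/rowP => k; rewrite !mxE -!PoszD (eqP (E k)).
Qed.

Definition edge_pair c i b := (set_coord c i b, set_coord c i (~~ b)).

(** The sum has entry 1 only at [i]; the entries 0 and 2 elsewhere determine both summands, so only
    the two orders of the edge remain. *)
Lemma ordered_pairs_edge c i :
  ordered_pairs (cube_vec (set_coord c i true) + cube_vec (set_coord c i false)) =
  [set edge_pair c i b | b : bool].
Proof.
apply/setP => -[c1 c2]; rewrite mem_ordered_pairs; apply/forallP/imsetP => [E|].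
  exists (c1 i) => //; congr pair; apply/ffunP => k; have /eqP := E k;
  rewrite /= !ffunE; case: eqP => [->|_]; move: (c1 _) (c2 _) => [] [] //=;
  by case: (c k).
by move=> [b _ [-> ->]] k; rewrite !ffunE; case: ifP => // _; case: b.
Qed.

Definition face_pair c i j (b : bool * bool) :=
  (set_coord (set_coord c i b.1) j b.2,
   set_coord (set_coord c i (~~ b.1)) j (~~ b.2)).

(** The sum has entry 1 exactly at [i] and [j], which leaves the two diagonals of the square, each
    in both orders. *)
Lemma ordered_pairs_face c i j : i != j ->
  ordered_pairs (cube_vec (set_coord (set_coord c i true) j true) +
                 cube_vec (set_coord (set_coord c i false) j false)) =
  [set face_pair c i j b | b : bool * bool].
Proof.
move=> ij.
apply/setP => -[c1 c2]; rewrite mem_ordered_pairs; apply/forallP/imsetP => [E|].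
  exists (c1 i, c1 j) => //; congr pair; apply/ffunP => k; have /eqP := E k;
  rewrite /= !ffunE; (case: eqP => [->|_]; last case: eqP => [->|_]);
  move: (c1 _) (c2 _) => [] [] //=;
  by case: (c k).
move=> [b _ [-> ->]] k; rewrite !ffunE.
by case: ifP => _; [case: b.2 | case: ifP => // _; case: b.1].
Qed.

Lemma edge_pair_inj c i : injective (edge_pair c i).
Proof. by move=> b b' [/ffunP/(_ i) + _]; rewrite !ffunE eqxx. Qed.

Lemma face_pair_inj c i j : i != j -> injective (face_pair c i j).
Proof.
move=> ij [b1 b2] [b1' b2'] [/ffunP E _]; move: (E i) (E j).
by rewrite !ffunE !eqxx (negbTE ij) => -> ->.
Qed.

(** The square relations make the ratio of [r] across an edge depend only on the direction of the
    edge. Climbing from the origin one coordinate at a time gives the product, with [lambda i] the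
    ratio at the origin. *)
Lemma square_multiplicative (F : fieldType) (r : cube g -> F) :
  (forall c, r c != 0) ->
  (forall c i j, i != j ->
     r (set_coord (set_coord c i true) j true) *
     r (set_coord (set_coord c i false) j false) =
     r (set_coord (set_coord c i true) j false) *
     r (set_coord (set_coord c i false) j true)) ->
  exists lambda : 'I_g -> F,
    forall c, r c = r [ffun=> false] * \prod_(i | c i) lambda i.
Proof.
move=> r0 sq; pose vert (s : seq 'I_g) : cube g := [ffun k => k \in s].
exists (fun i => r (vert [:: i]) / r [ffun=> false]).
have vert0 : vert [::] = [ffun=> false] by apply/ffunP => k; rewrite !ffunE.
(* The square at [vert s] in directions [i] and [j] moves the edge in direction [i] one step closer
   to the origin. *)
have step i s : uniq (i :: s) ->
    r (vert (i :: s)) * r [ffun=> false] = r (vert s) * r (vert [:: i]).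
  elim: s => [|j s IHs] /=.
    by move=> _; rewrite mulrC vert0.
  rewrite inE negb_or => /and3P[/andP[ij is_] js us].
  apply: (mulfI (r0 (vert s))); have := sq (vert s) i j ij.
  have -> : set_coord (set_coord (vert s) i true) j true = vert [:: i, j & s].
    by apply/ffunP => k; rewrite !ffunE !inE; do !case: eqP.
  have -> : set_coord (set_coord (vert s) i false) j false = vert s.
    apply/ffunP => k; rewrite !ffunE; case: eqP => [->|_]; first by rewrite (negbTE js).
    by case: eqP => [->|//]; rewrite (negbTE is_).
  have -> : set_coord (set_coord (vert s) i true) j false = vert (i :: s).
    apply/ffunP => k; rewrite !ffunE !inE; case: eqP => [->|_]; last by case: eqP.
    by rewrite eq_sym (negbTE ij) (negbTE js).
  have -> : set_coord (set_coord (vert s) i false) j true = vert (j :: s).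
    apply/ffunP => k; rewrite !ffunE !inE; case: eqP => //= _.
    by case: eqP => [->|//]; rewrite (negbTE is_).
  rewrite mulrC mulrA => ->; rewrite mulrAC IHs /= ?is_ //.
  by rewrite mulrAC -mulrA.
have vertP s : uniq s -> r (vert s) = r [ffun=> false] *
    \prod_(i <- s) (r (vert [:: i]) / r [ffun=> false]).
  elim: s => [_|i s IHs us].
    by rewrite big_nil mulr1 vert0.
  apply: (mulIf (r0 [ffun=> false])); rewrite step // big_cons IHs //; last first.
    by case/andP: us.
  by field; apply: r0.
move=> c; rewrite -big_enum -vertP ?enum_uniq //; congr r.
by apply/ffunP => k; rewrite ffunE mem_enum.
Qed.

End Faces.

(** * Recovering lambda and kappa at a generic point *)

Section Reconstruction.
Variables (R : realType) (g : nat).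
Local Notation C := R[i].
Implicit Types (c : cube g) (i j : 'I_g) (q : cube g * cube g).
Implicit Types (a : {ffun cube g -> C}) (x : 'M[C]_(3, g)).
Implicit Types (lambda : 'I_g -> C) (kappa : 'I_(2 * g) -> C).

Lemma half_index_subproof (k : 'I_(2 * g)) : (k./2 < g)%N.
Proof. by rewrite ltn_half_double -mul2n. Qed.

Definition half_index k := Ordinal (half_index_subproof k).

(* Since v / u = kappa_{2i-1} + kappa_{2i} and u = kappa_{2i-1} - kappa_{2i}. *)
Definition kappa_of x (k : 'I_(2 * g)) : C :=
  (x 1 (half_index k) / x 0 (half_index k) +
   (-1) ^+ odd k * x 0 (half_index k)) / 2.

Lemma kappa_of_index x i b :
  kappa_of x (kappa_index i b) = (x 1 i / x 0 i + (-1) ^+ (~~ b) * x 0 i) / 2.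
Proof.
rewrite /kappa_of.
have -> : half_index (kappa_index i b) = i.
  by apply: val_inj; rewrite /= mul2n addnC half_bit_double.
by rewrite /= mul2n oddD odd_double; case: b.
Qed.

(** As 2 u_i kappa equals v_i plus or minus u_i^2, this is 2 u_i u_j times a difference of two
    kappas. *)
Definition discr_factor i j (b b' : bool) : cpoly R g :=
  let U k : cpoly R g := cvar R (inr (0, k)) in
  let V k : cpoly R g := cvar R (inr (1, k)) in
  (V i + (-1) ^+ (~~ b) * U i ^+ 2) * U j - (V j + (-1) ^+ (~~ b') * U j ^+ 2) * U i.

(* Up to units, the product of all u_i and of all differences of two kappas with
   different indices i, cleared of denominators in u. *)
Definition discr : cpoly R g :=
  (\prod_i cvar R (inr (0, i))) *
  \prod_i \prod_(j | i != j) \prod_(b : bool) \prod_(b' : bool) discr_factor i j b b'.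

Lemma whomog_discr : whomog discr.
Proof.
have X0 i : whomog_deg 1 (cvar R (inr (0, i)) : cpoly R g).
  exact: (@whomog_deg_cvar R g (inr (0, i))).
have X1 i : whomog_deg 2 (cvar R (inr (1, i)) : cpoly R g).
  exact: (@whomog_deg_cvar R g (inr (1, i))).
have VU i (b : bool) : whomog_deg 2 ((cvar R (inr (1, i)) : cpoly R g) +
    (-1) ^+ (~~ b) * cvar R (inr (0, i)) ^+ 2).
  apply: whomog_degD => //; rewrite -signr_odd; case: (odd _).
    by rewrite expr1 mulN1r; apply/whomog_degN/(whomog_degX (n := 2) (X0 i)).
  by rewrite expr0 mul1r; apply/(whomog_degX (n := 2) (X0 i)).
apply: whomogM; first by apply: whomog_prod => i _; exists 1%N; apply: X0.
apply: whomog_prod => i _; apply: whomog_prod => j _.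
apply: whomog_prod => b _; apply: whomog_prod => b' _.
exists 3%N; apply: whomog_degD; last apply: whomog_degN.
  exact: (whomog_degM (VU i b) (X0 j)).
exact: (whomog_degM (VU j b') (X0 i)).
Qed.

Lemma discr_neq0 a x : discr.@[coord_val a x] != 0 <->
  (forall i, x 0 i != 0) /\
  (forall i j b b', i != j ->
     kappa_of x (kappa_index i b) != kappa_of x (kappa_index j b')).
Proof.
have factorE i j b b' : x 0 i != 0 -> x 0 j != 0 ->
    (discr_factor i j b b').@[coord_val a x] = 2 * x 0 i * x 0 j *
      (kappa_of x (kappa_index i b) - kappa_of x (kappa_index j b')).
  move=> i0 j0; rewrite !kappa_of_index /discr_factor.
  rewrite rmorphB !rmorphM !rmorphD !rmorphM !rmorph_sign ?rmorphXn /=.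
  by rewrite !meval_cvar /=; field; rewrite i0 j0.
rewrite /discr rmorphM !rmorph_prod /= mulf_eq0 negb_or.
split=> [/andP[]|[x0 k0]].
  rewrite !prodf_seq_neq0 => /allP u0 /allP D0.
  have x0 i : x 0 i != 0 by have := u0 i (mem_index_enum _); rewrite meval_cvar.
  split=> // i j b b' ij; have := D0 i (mem_index_enum _).
  rewrite /= rmorph_prod prodf_seq_neq0 => /allP/(_ j (mem_index_enum _)).
  rewrite ij /= rmorph_prod prodf_seq_neq0 => /allP/(_ b (mem_index_enum _)).
  rewrite /= rmorph_prod prodf_seq_neq0 => /allP/(_ b' (mem_index_enum _)).
  by rewrite /= factorE // mulf_eq0 negb_or subr_eq0 => /andP[].
apply/andP; split.
  by rewrite prodf_seq_neq0; apply/allP => i _; rewrite meval_cvar x0.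
rewrite prodf_seq_neq0; apply/allP => i _ /=.
rewrite rmorph_prod prodf_seq_neq0; apply/allP => j _; apply/implyP => ij.
rewrite rmorph_prod prodf_seq_neq0; apply/allP => b _ /=.
rewrite rmorph_prod prodf_seq_neq0; apply/allP => b' _ /=.
by rewrite factorE // !mulf_neq0 ?pnatr_eq0 // subr_eq0 k0.
Qed.

Lemma phi_a_neq0 lambda kappa c : (forall i, lambda i != 0) ->
  (forall i j b b', i != j -> kappa (kappa_index i b) != kappa (kappa_index j b')) ->
  phi_a lambda kappa c != 0.
Proof.
move=> l0 k0; rewrite phi_aE mulf_neq0 //.
  rewrite prodf_seq_neq0; apply/allP => i _ /=.
  rewrite prodf_seq_neq0; apply/allP => j _ /=; apply/implyP => ij.
  by rewrite subr_eq0 k0 // -val_eqE neq_ltn ij.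
by rewrite prodf_seq_neq0; apply/allP => i _; apply/implyP.
Qed.

Lemma cube_dot_edge x c i b (e : 'I_3) :
  cube_dot x (set_coord c i b) (set_coord c i (~~ b)) e = (-1) ^+ (~~ b) * x e i.
Proof.
rewrite /cube_dot (bigD1 i) //= big1 ?addr0 => [|k ki].
  by rewrite !mxE !ffunE eqxx; case: b => /=; ring.
by rewrite !mxE !ffunE (negbTE ki) subrr mul0r.
Qed.

Lemma cube_dot_face x c i j b (e : 'I_3) : i != j ->
  cube_dot x (face_pair c i j b).1 (face_pair c i j b).2 e =
  (-1) ^+ (~~ b.1) * x e i + (-1) ^+ (~~ b.2) * x e j.
Proof.
move=> ij; rewrite /cube_dot (bigD1 i) //= (bigD1 j) 1?eq_sym //=.
rewrite big1 ?addr0 => [|k /andP[ki kj]].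
  rewrite !mxE !ffunE !eqxx (negbTE ij).
  by case: b => [[] []] /=; ring.
by rewrite !mxE !ffunE (negbTE ki) (negbTE kj) subrr mul0r.
Qed.

Lemma hirota_edge a x c i : (forall c, a c != 0) ->
  \sum_(q in ordered_pairs (cube_vec (set_coord c i true) +
     cube_vec (set_coord c i false))) hirota_val x q.1 q.2 * (a q.1 * a q.2) = 0 ->
  hirota_quartic (x 0 i) (x 1 i) (x 2 i) = 0.
Proof.
move=> a0; rewrite ordered_pairs_edge (big_imset _ (in2W (@edge_pair_inj g c i))) /=.
rewrite big_bool /= /hirota_val !(cube_dot_edge x c i true) !(cube_dot_edge x c i false) /=.
set u := x 0 i; set v := x 1 i; set w := x 2 i.
set A := a _; set B := a _ => E.
(* The quartic is even, so the two orders of the edge contribute equally. *)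
have {E} : 2 * (A * B) * hirota_quartic u v w = 0.
  by rewrite -E /hirota_quartic; ring.
by move/eqP; rewrite !mulf_eq0 pnatr_eq0 !(negbTE (a0 _)) => /eqP.
Qed.

(** The two sides come from the two diagonals of the square, each counted in both orders; the common
    factor 2 is cancelled. *)
Lemma hirota_face a x c i j : i != j ->
  \sum_(q in ordered_pairs
     (cube_vec (set_coord (set_coord c i true) j true) +
      cube_vec (set_coord (set_coord c i false) j false)))
     hirota_val x q.1 q.2 * (a q.1 * a q.2) = 0 ->
  hirota_quartic (x 0 i + x 0 j) (x 1 i + x 1 j) (x 2 i + x 2 j) *
    (a (set_coord (set_coord c i true) j true) *
     a (set_coord (set_coord c i false) j false)) =
  - hirota_quartic (x 0 i - x 0 j) (x 1 i - x 1 j) (x 2 i - x 2 j) *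
    (a (set_coord (set_coord c i true) j false) *
     a (set_coord (set_coord c i false) j true)).
Proof.
move=> ij; have sumE (G : bool * bool -> C) : \sum_b G b =
    G (true, true) + G (true, false) + (G (false, true) + G (false, false)).
  rewrite (eq_bigr (fun b => G (b.1, b.2))) => [|[]//].
  by rewrite -(pair_bigA _ (fun b b' => G (b, b'))) !big_bool.
rewrite ordered_pairs_face // (big_imset _ (in2W (face_pair_inj ij))).
rewrite sumE /hirota_val !cube_dot_face //=.
set a1 := a _; set a2 := a _; set a3 := a _; set a4 := a _ => E.
apply: (mulfI (_ : 2 != 0)); first by rewrite pnatr_eq0.
apply/eqP; rewrite -subr_eq0; apply/eqP; rewrite -E /hirota_quartic; ring.
Qed.

(** The quartic equation is linear in w with coefficient -4u, so it determines w from u and v, and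
    the difference of the cubes of the kappas is that same value. *)
Lemma phi_uvw_kappa_of x : (forall i, x 0 i != 0) ->
  (forall i, hirota_quartic (x 0 i) (x 1 i) (x 2 i) = 0) ->
  phi_uvw (kappa_of x) = x.
Proof.
move=> x0 Q0; apply/matrixP => e i; rewrite mxE !kappa_of_index.
have w : x 2 i = (x 0 i ^+ 4 + 3 * x 1 i ^+ 2) / (4 * x 0 i).
  apply: (mulIf (_ : 4 * x 0 i != 0)); first by rewrite mulf_neq0 ?pnatr_eq0.
  rewrite divfK ?mulf_neq0 ?pnatr_eq0 //.
  by apply/eqP; rewrite eq_sym -subr_eq0 -(Q0 i); apply/eqP; rewrite /hirota_quartic; ring.
have I3 (P : 'I_3 -> Prop) : P 0 -> P 1 -> P 2 -> forall e, P e.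
  move=> P0 P1 P2 [[|[|[|//]]] e3].
  - by rewrite (_ : Ordinal e3 = 0) //; apply: val_inj.
  - by rewrite (_ : Ordinal e3 = 1) //; apply: val_inj.
  - by rewrite (_ : Ordinal e3 = 2) //; apply: val_inj.
by elim/I3: e => /=; rewrite ?w; field; rewrite x0.
Qed.

(** This factorization shows that the coefficient in a square relation is nonzero where [discr]
    is. *)
Lemma quartic_sum_kappa (x1 y1 x2 y2 : C) :
  hirota_quartic ((x1 - y1) + (x2 - y2)) ((x1 ^+ 2 - y1 ^+ 2) + (x2 ^+ 2 - y2 ^+ 2))
    ((x1 ^+ 3 - y1 ^+ 3) + (x2 ^+ 3 - y2 ^+ 3)) =
  - 12 * (x1 - y1) * (x2 - y2) * (x1 - y2) * (y1 - x2).
Proof. by rewrite /hirota_quartic; ring. Qed.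

(** The product of differences is homogeneous in kappa; its degree g(g-1)/2 is written as the number
    of pairs i < j. *)
Lemma phi_aZ lambda kappa t c :
  phi_a lambda (fun k => t * kappa k) c =
  t ^+ (\sum_(i < g) #|[pred j : 'I_g | i < j]|)%N * phi_a (fun=> 1) kappa c *
  \prod_(i | c i) lambda i.
Proof.
rewrite !phi_aE [X in _ * (_ * X)]big1 // mulr1; congr (_ * _).
rewrite expr_sum -big_split; apply: eq_bigr => i _ /=.
by rewrite -prodr_const -big_split; apply: eq_bigr => j _; rewrite /= mulrBr.
Qed.

Lemma phi_uvwZ kappa t : phi_uvw (fun k => t * kappa k) = wscale t (phi_uvw kappa).
Proof. by apply/matrixP => e i; rewrite !mxE !exprMn mulrBr. Qed.

(* Off the zero set of discr, the edges of the cube determine w, hence kappa,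
   and the squares determine the cross ratios of the a_c. *)
Lemma hirota_variety_generic p : (1 < g)%N ->
  hirota_variety R g p -> ~ vanishes_at discr p -> phi_image p.
Proof.
move=> g1 pH /existsNP[x /not_implyP[xp /eqP/discr_neq0[x0 k0]]].
have {}pH := (hirota_varietyP xp).1 pH.
have a0 c : val p.1 c != 0 by move/forallP: (valP p.1); apply.
have dsum c1 c2 i : c1 i != c2 i -> distinct_sum (cube_vec c1 + cube_vec c2).
  by move=> ne; exists c1, c2; split=> //; apply: contraNneq ne => ->.
have xE : phi_uvw (kappa_of (val x)) = val x.
  apply: phi_uvw_kappa_of => // i; apply: (hirota_edge (c := [ffun=> false]) a0).
  by apply: pH; apply: (dsum _ _ i); rewrite !ffunE eqxx.
(* [b] is the reference value of phi with these kappas and all lambdas 1; the ratio of [a] to [b] is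
   to be a constant times a product of lambdas. *)
pose kappa := kappa_of (val x); pose b c := phi_a (fun=> 1) kappa c.
have b0 c : b c != 0 by apply: phi_a_neq0 => // i; rewrite oner_neq0.
have sumb d : \sum_(q in ordered_pairs d) hirota_val (val x) q.1 q.2 *
    ([ffun c => b c] q.1 * [ffun c => b c] q.2) = 0.
  rewrite -{1}xE -[RHS](sum_hirota_phi (fun=> 1) kappa d).
  by apply: eq_bigr => q _; rewrite !ffunE.
have [||lambda lE] := square_multiplicative (r := fun c => val p.1 c / b c).
- by move=> c; rewrite mulf_neq0 // invr_neq0.
- move=> c i j ij.
  have dP : distinct_sum (cube_vec (set_coord (set_coord c i true) j true) +
      cube_vec (set_coord (set_coord c i false) j false)).
    by apply: (dsum _ _ j); rewrite !ffunE eqxx.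
  (* Both [a] and [b] satisfy the square relation with the same coefficients [P1] and [P2]. As [P1]
     is nonzero, their ratio is multiplicative on the square. *)
  have Ea := hirota_face ij (pH _ dP).
  have := @hirota_face [ffun c => b c] (val x) c i j ij (sumb _).
  rewrite !ffunE => Eb.
  set P1 := hirota_quartic _ _ _ in Ea Eb; set P2 := hirota_quartic _ _ _ in Ea Eb.
  have P10 : P1 != 0.
    rewrite /P1 -xE !mxE quartic_sum_kappa !mulf_neq0 ?oppr_eq0 ?pnatr_eq0 //;
      try (by rewrite subr_eq0 k0 // eq_sym).
    + have := x0 i; by rewrite -{1}xE mxE !expr1.
    + have := x0 j; by rewrite -{1}xE mxE !expr1.
  move: Ea Eb.
  set c1 := set_coord _ j true; set c2 := set_coord _ j false.
  set c3 := set_coord _ j false; set c4 := set_coord _ j true => Ea Eb.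
  apply: (mulfI (mulf_neq0 (mulf_neq0 P10 (mulf_neq0 (b0 c1) (b0 c2)))
    (mulf_neq0 (b0 c3) (b0 c4)))).
  transitivity (P1 * (val p.1 c1 * val p.1 c2) * (b c3 * b c4)); first by field; rewrite !b0.
  by rewrite Ea Eb; field; rewrite !b0.
(* [N] is positive because 1 < g, so the ratio at the origin has an N-th root [t]; scaling kappa by
   [t] multiplies every [phi_a] by that ratio. *)
set N := (\sum_(i < g) #|[pred j : 'I_g | i < j]|)%N.
have N0 : (0 < N)%N.
  rewrite /N (bigD1 (Ordinal (ltnW g1))) //= ltn_addr //.
  by apply/card_gt0P; exists (Ordinal g1).
set r0 := val p.1 [ffun=> false] / b [ffun=> false] in lE.
pose t := N.-root r0; have tN : t ^+ N = r0 by rewrite rootCK.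
have t0 : t != 0.
  apply: contraTneq isT => t0; have /eqP : r0 = 0 by rewrite -tN t0 expr0n gtn_eqF.
  by rewrite mulf_eq0 invr_eq0 !(negbTE (a0 _), negbTE (b0 _)).
exists lambda, (fun k => t * kappa k); split=> [c|].
  by rewrite phi_aZ tN -/(b c) mulrAC -lE divfK.
have xs0 : wscale t (val x) != 0.
  apply: contraNneq (x0 (Ordinal (ltnW g1))) => /matrixP/(_ 0 (Ordinal (ltnW g1)))/eqP.
  by rewrite !mxE mulf_eq0 expf_eq0 (negbTE t0).
exists (Sub (wscale t (val x)) xs0 : punctured R g).
  by rewrite SubK phi_uvwZ xE.
rewrite -xp; apply/eqmodP/asboolP; exists t => //; by rewrite SubK.
Qed.

(** Distinct integers for the kappas and 1 for the lambdas give such a point, since [kappa_of]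
    recovers the chosen kappas. *)
Lemma phi_image_discr : (0 < g)%N ->
  exists2 p : ambient R g, phi_image p & ~ vanishes_at discr p.
Proof.
move=> g0; pose kappa (k : 'I_(2 * g)) : C := k%:R.
have kinj : injective kappa by move=> k l /eqP; rewrite eqr_nat => /eqP/val_inj.
have kne i j b b' : i != j -> kappa (kappa_index i b) != kappa (kappa_index j b').
  move=> ij; rewrite (inj_eq kinj); apply: contraNneq ij => E.
  have := congr1 (fun k : 'I__ => (nat_of_ord k)./2) E.
  rewrite /= !mul2n ![(_.*2 + _)%N]addnC !half_bit_double => /val_inj ->.
  by rewrite eqxx.
have u0 i : phi_uvw kappa 0 i != 0.
  by rewrite mxE !expr1 subr_eq0 (inj_eq kinj) -val_eqE /= eqn_add2l.
have l0 i : (fun=> 1 : C) i != 0 :> C by apply: oner_neq0.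
have [c||p Gp] := @phi_graph_exists R g (fun=> 1) kappa.
- exact: phi_a_neq0.
- by apply: contraNneq (u0 (Ordinal g0)) => ->; rewrite mxE.
exists p; first by exists (fun=> 1), kappa.
move=> /(vanishes_at_phi whomog_discr Gp)/eqP; apply/negP.
apply/discr_neq0; split=> // i j b b' ij.
have kE k b0 : kappa_of (phi_uvw kappa) (kappa_index k b0) = kappa (kappa_index k b0).
  rewrite kappa_of_index; have := u0 k; rewrite !mxE !expr1 => uk.
  rewrite subr_sqr [_ * (_ + _)]mulrC mulfK //.
  by case: b0 => /=; field.
by rewrite !kE kne.
Qed.

End Reconstruction.

Theorem theorem3 (R : realType) (g : nat) (g_gt1 : (1 < g)%N)
    (g_le9 : (g <= 9)%N) :
  irreducible_component (main_component R g) (hirota_variety R g).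
Proof.
have [p pI pD] := @phi_image_discr R g (ltnW g_gt1).
split; first by apply: main_component_irreducible; exists p.
  exact: main_component_sub_hirota.
move=> Y [_ Yirr] YH MY; apply/seteqP; split=> // q Yq Z [cZ IZ].
have cD : zariski_closed (zeros [set @discr R g]%classic).
  by exists [set @discr R g]%classic => // _ ->; apply: whomog_discr.
(* Off the zeros of [discr], [Y] lies in the image of phi, hence in the closed set [Z] containing
   that image. By irreducibility [Y] lies in one of the two closed sets, and the zeros of [discr]
   miss the point [p] of [Y]. *)
have [|YD|] := Yirr _ Z cD cZ; last exact.
- move=> y /YH yH; have [yD|yD] := pselect (vanishes_at (@discr R g) y).
    by left=> _ ->.
  by right; apply/IZ/hirota_variety_generic.
- by case: pD; exact: (YD p (MY p (phi_image_sub_closure pI)) _ erefl).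
Qed.
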